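(* Let $q$ be a power of an odd prime, let $\lambda\in\mathbb{F}_q$ be a non-square, and let $f\in\mathbb{F}_q[X]$ be a permutation polynomial of $\mathbb{F}_q$. Let $H$ be any Hamiltonian cycle of any (weakly) connected component of $\mathcal{G}(\lambda,f)$, and let $s$ be the binary sequence obtained by recording, in order along $H$, the weights of the edges of $H$. Then $s$ is balancing: the numbers of $0$'s and of $1$'s in $s$ differ by at most $1$.
   Context: For a polynomial $f\in\mathbb{F}_q[X]$ and a non-square $\lambda\in\mathbb{F}_q$, $\mathcal{G}(\lambda,f)$ is the directed graph with vertex set $\mathbb{F}_q$ and an edge from $x$ to $y$ iff $(y^2-f(x))(\lambda y^2-f(x))=0$ (loops allowed). Weights: an edge $(x,y)$ has weight $0$ if $y^2=f(x)$ and weight $1$ otherwise (i.e. if $\lambda y^2=f(x)$ and $y^2\neq f(x)$); in particular the edge going to the vertex $0$ has weight $0$. *)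

(* Defs.v *)
From HB Require Import structures.
From mathcomp Require Import all_boot all_order all_algebra.

Set Implicit Arguments.
Unset Strict Implicit.
Unset Printing Implicit Defensive.

Import GRing.Theory Num.Theory.
Local Open Scope ring_scope.

Section Digraphs.
Variables (T : finType) (e : rel T).

Definition weak_adj : rel T := [rel x y | e x y || e y x].

Definition weak_components : {set {set T}} :=
  equivalence_partition (connect weak_adj) [set: T].

(* [c] lists the vertices in order, from an arbitrary starting vertex; [cycle]
   also requires the closing edge from the last vertex to the first, so a
   one-vertex cycle is a loop. *)
Definition hamiltonian_cycle (C : {set T}) (c : seq T) : Prop :=
  [/\ cycle e c, uniq c & c =i C].

End Digraphs.

Definition is_square (F : finFieldType) (a : F) : Prop :=
  exists y : F, a = y ^+ 2.

Definition permutation_poly (F : finFieldType) (f : {poly F}) : Prop :=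
  bijective (fun x : F => f.[x]).

Definition graphG (F : finFieldType) (lam : F) (f : {poly F}) : rel F :=
  [rel x y | (y ^+ 2 - f.[x]) * (lam * y ^+ 2 - f.[x]) == 0].

(* Weights 0 and 1 are encoded as [false] and [true]. Meaningful only on edges
   of [graphG lam f], hence the absence of [lam]. *)
Definition edge_weight (F : finFieldType) (f : {poly F}) (x y : F) : bool :=
  y ^+ 2 != f.[x].

Definition weight_seq (F : finFieldType) (f : {poly F}) (c : seq F) : bitseq :=
  [seq edge_weight f x (next c x) | x <- c].

Definition balancing (s : bitseq) : Prop :=
  `|(count_mem false s)%:Z - (count_mem true s)%:Z| <= 1.

(* Main.v *)
(** Every nonzero vertex [y] has the same in-neighbours as [- y], namely the
    preimages under [f] of [y ^+ 2] and [lam * y ^+ 2]. So [- y] lies in the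
    component of [y], and a Hamiltonian cycle enters [y] and [- y] from
    different in-neighbours, hence with opposite weights. Only the edge entering
    [0], of weight [0], is left unpaired. *)
Require Import Defs.
From HB Require Import structures.
From mathcomp Require Import all_boot all_order all_algebra finfield.

Set Implicit Arguments.
Unset Strict Implicit.
Unset Printing Implicit Defensive.

Import GRing.Theory Num.Theory.

Local Open Scope ring_scope.

Lemma perm_map_next (T : eqType) (s : seq T) :
  uniq s -> perm_eq (map (next s) s) s.
Proof.
move=> s_uniq; apply: uniq_perm => //.
  by rewrite map_inj_uniq //; apply: can_inj (prev_next s_uniq).
move=> y; apply/mapP/idP => [[x xs ->]|ys]; first by rewrite mem_next.
by exists (prev s y); rewrite ?mem_prev ?next_prev.
Qed.

Lemma count_uniq_card (T : finType) (P : pred T) (s : seq T) :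
  uniq s -> count P s = #|[set y | (y \in s) && P y]|.
Proof.
move=> s_uniq; rewrite -size_filter -(card_uniqP (filter_uniq P s_uniq)).
by rewrite cardsE; apply: eq_card => y; rewrite mem_filter andbC.
Qed.

(** [next s] permutes the vertices of [s], so the edges can be indexed by their heads instead of
    their tails. This makes negation act on the counted sets, since it pairs edges by their
    heads. *)
Lemma count_weight_seq (F : finFieldType) (f : {poly F}) (s : seq F) (b : bool) :
  uniq s ->
  count_mem b (weight_seq f s) =
  #|[set y | (y \in s) && (edge_weight f (prev s y) y == b)]|.
Proof.
move=> s_uniq; rewrite -count_uniq_card //.
rewrite -(permP (perm_map_next s_uniq)) !count_map.
by apply: eq_count => x /=; rewrite prev_next.
Qed.

Lemma weak_component_closed (T : finType) (e : rel T) (C : {set T}) (x y : T) :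
  C \in weak_components e -> e x y -> x \in C -> y \in C.
Proof.
case/imsetP=> z _ -> exy; rewrite !inE /= => zx.
by apply: connect_trans zx _; apply: connect1; rewrite /weak_adj /= exy.
Qed.

(** Otherwise [2 * y = 0] with [y != 0], so the characteristic [p] would divide 2. *)
Lemma finField_oppr_neq (F : finFieldType) (p k : nat) (y : F) :
  prime p -> odd p -> #|F| = (p ^ k)%N -> y != 0 -> - y != y.
Proof.
move=> p_prime p_odd card_F y0; have pF := card_finPcharP card_F p_prime.
rewrite eq_sym -subr_eq0 opprK -mulr2n.
rewrite -mulr_natl mulf_eq0 (negbTE y0) orbF -(dvdn_pcharf pF).
by apply/negP => /dvdn_leq - /(_ isT); case: p p_prime p_odd {card_F pF} => [|[|[|]]].
Qed.

Section HamiltonianCycle.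
Variables (F : finFieldType) (lam : F) (f : {poly F}) (C : {set F}) (H : seq F).
Hypotheses (f_inj : injective (fun x : F => f.[x]))
  (C_comp : C \in weak_components (graphG lam f))
  (H_ham : hamiltonian_cycle (graphG lam f) C H).

Lemma hamiltonian_cycle_oppr (y : F) : y \in H -> - y \in H.
Proof.
case: H_ham => cH _ HC yH; rewrite HC.
apply: (weak_component_closed C_comp (x := prev H y)).
  by have := prev_cycle cH yH; rewrite /graphG /= sqrrN.
by rewrite -HC mem_prev.
Qed.

Lemma prev_graphG (y : F) : y \in H ->
  f.[prev H y] = y ^+ 2 \/ f.[prev H y] = lam * y ^+ 2.
Proof.
case: H_ham => cH _ _ yH; have := prev_cycle cH yH.
by rewrite /graphG /= mulf_eq0 !subr_eq0 => /orP[]/eqP <-; [left|right].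
Qed.

(** At [y = 0] the values [y ^+ 2] and [lam * y ^+ 2] coincide. *)
Lemma edge_weight_prev0 : 0 \in H -> edge_weight f (prev H 0) 0 = false.
Proof.
by rewrite /edge_weight => /prev_graphG; rewrite expr0n mulr0 => -[]->; rewrite eqxx.
Qed.

Lemma edge_weight_prevN (y : F) : y \in H -> - y != y ->
  edge_weight f (prev H (- y)) (- y) = ~~ edge_weight f (prev H y) y.
Proof.
case: (H_ham) => _ H_uniq _ yH y_neq; rewrite /edge_weight sqrrN.
(* Both [prev H] and evaluation of [f] are injective. *)
have fN : f.[prev H (- y)] != f.[prev H y].
  by rewrite (inj_eq f_inj) (inj_eq (can_inj (next_prev H_uniq))).
have := prev_graphG (hamiltonian_cycle_oppr yH); rewrite sqrrN.
(* Of the four combinations of values, [fN] excludes the two equal ones; in the two mixed ones it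
   reads [y ^+ 2 != lam * y ^+ 2], so exactly one of the weights is 0. *)
case: (prev_graphG yH) fN => -> /[swap] -[]->; rewrite ?eqxx //= eq_sym.
  by move->.
by move/negbTE; rewrite eq_sym => ->.
Qed.

End HamiltonianCycle.

Theorem theorem2p13 (F : finFieldType) (p k : nat)
    (p_prime : prime p) (p_odd : odd p) (card_F : #|F| = (p ^ k)%N)
    (lam : F) (lam_nonsquare : ~ is_square lam)
    (f : {poly F}) (f_perm : permutation_poly f)
    (C : {set F}) (C_comp : C \in weak_components (graphG lam f))
    (H : seq F) (H_ham : hamiltonian_cycle (graphG lam f) C H) :
  balancing (weight_seq f H).
Proof.
have f_inj := bij_inj f_perm; case: (H_ham) => _ H_uniq _.
have wN y : y \in H -> y != 0 ->
    edge_weight f (prev H (- y)) (- y) = ~~ edge_weight f (prev H y) y.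
  move=> yH /(finField_oppr_neq p_prime p_odd card_F).
  by apply: (edge_weight_prevN f_inj C_comp).
rewrite /balancing !count_weight_seq //.
set A0 := [set y | _ & _ == false]; set A1 := [set y | _ & _ == true].
have A0E : A0 :\ 0 = -%R @: A1.
  apply/setP => y; apply/idP/imsetP => [|[z + ->]].
    rewrite !inE => /and3P[y0 yH /eqP wy]; exists (- y); last by rewrite opprK.
    by rewrite inE (hamiltonian_cycle_oppr C_comp H_ham) //= wN // wy.
  rewrite !inE => /andP[zH /eqP wz].
  (* Vertex [0] is never in [A1], so removing it from [A0] alone suffices. *)
  have z0 : z != 0.
    by apply: contraTneq wz => z0; rewrite z0 in zH *; rewrite (edge_weight_prev0 H_ham).
  by rewrite oppr_eq0 z0 (hamiltonian_cycle_oppr C_comp H_ham) //= wN // wz.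
(* The difference of the counts is the boolean [0 \in A0], read as 0 or 1. *)
rewrite (cardsD1 0 A0) A0E (card_imset _ oppr_inj) PoszD addrK.
by case: (_ \in _).
Qed.
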